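(* Let $\mathcal{B}$ be a bicategory and let $\mathfrak{W}$ be a class of co-ff (co-fully-faithful) arrows in $\mathcal{B}$ satisfying conditions [WB1]--[WB5]. Then each 2-cell in $\mathcal{B}(\mathfrak{W}^{-1})$ has at most one representative with a given left-hand 2-cell. That is, if $(\alpha,\beta;s_1,s_2)$ and $(\alpha,\gamma;s_1,s_2)$ are equivalent 2-cell diagrams between the same spans, then $\beta=\gamma$.
   Context: Associativity and unit constraints are suppressed; $gf$ is $f$ followed by $g$; $\alpha f$, $g\alpha$ are whiskerings; $(\beta)(\alpha)$ is vertical composition ($\alpha$ first). An arrow $w$ is co-ff if for any 2-cell $\alpha\colon fw\Rightarrow gw$ there is a unique 2-cell $\alpha'\colon f\Rightarrow g$ with $\alpha'w=\alpha$. **Conditions on $\mathfrak{W}$.** [WB1] All identities are in $\mathfrak{W}$. [WB2] For composable $v\colon B\to C$, $w\colon C\to D$ in $\mathfrak{W}$ there is an arrow $u\colon A\to B$ with $wvu\in\mathfrak{W}$. [WB3] For $w\colon A\to B$ in $\mathfrak{W}$ and $f\colon C\to B$ there are $h\colon D\to A$, $v\colon D\to C$ with $v\in\mathfrak{W}$ and an invertible 2-cell $\alpha\colon wh\Rightarrow fv$. [WB4] For any 2-cell $\alpha\colon wf\Rightarrow wg$ with $w\in\mathfrak{W}$ there are $u\in\mathfrak{W}$ and a 2-cell $\beta\colon fu\Rightarrow gu$ with $\alpha u=w\beta$; and if $(u_1,\beta_1)$, $(u_2,\beta_2)$ are two such pairs, there are arrows $s,t$ with $u_1s,u_2t\in\mathfrak{W}$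 and an invertible 2-cell $\varepsilon\colon u_1s\Rightarrow u_2t$ with $(g\varepsilon)(\beta_1s)=(\beta_2t)(f\varepsilon)$. [WB5] If $w\in\mathfrak{W}$ and there is an invertible 2-cell $v\Rightarrow w$, then $v\in\mathfrak{W}$. **2-cells of the bicategory of fractions $\mathcal{B}(\mathfrak{W}^{-1})$.** Objects are those of $\mathcal{B}$. An arrow $A\to B$ is a span $(u,f)$: $A\xleftarrow{u}C\xrightarrow{f}B$ with $u\in\mathfrak{W}$. A 2-cell diagram from $(u_1,f_1)$ (apex $C_1$) to $(u_2,f_2)$ (apex $C_2$) is a tuple $(\alpha,\beta;s_1,s_2)$ with $s_i\colon D\to C_i$, an invertible 2-cell $\alpha\colon u_1s_1\Rightarrow u_2s_2$ and a 2-cell $\beta\colon f_1s_1\Rightarrow f_2s_2$, such that $u_1s_1\in\mathfrak{W}$; $\alpha$ (with $s_1,s_2$) is the left-hand 2-cell and $\beta$ the right-hand 2-cell. It is equivalent to $(\alpha',\beta';s_1',s_2')$ (with $s_i'\colon D'\to C_i$) iff there are $p\colon E\to D$, $q\colon E\to D'$ and invertible $\varepsilon_i\colon s_ip\Rightarrow s_i'q$ ($i=1,2$) with $u_1s_1p\in\mathfrak{W}$, $(u_2\varepsilon_2)(\alpha p)=(\alpha'q)(u_1\varepsilon_1)$ and $(f_2\varepsilon_2)(\beta p)=(\beta'q)(f_1\varepsilon_1)$. 2-cells are equivalence classes of 2-cell diagrams; members of a class are its representatives. *)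

(* Defs.v *)
Declare Scope bicat_scope.
Delimit Scope bicat_scope with bicat.
Local Open Scope bicat_scope.

Reserved Notation "f ⇒ g" (at level 60, no associativity).
Reserved Notation "g ∘ f" (at level 40, left associativity).
Reserved Notation "β • α" (at level 50, left associativity).
Reserved Notation "g ◁ α" (at level 38, right associativity).
Reserved Notation "β ▷ f" (at level 38, right associativity).

(** Composites are written in applicative order: [g ∘ f] is [f] followed by
    [g], and [β • α] is [α] followed by [β]. *)

Record bicat_data := BicatData {
  ob :> Type;
  arr : ob -> ob -> Type;
  cell : forall {A B : ob}, arr A B -> arr A B -> Type;
  id1 : forall A : ob, arr A A;
  comp1 : forall {A B C : ob}, arr B C -> arr A B -> arr A C;
  id2 : forall {A B : ob} (f : arr A B), cell f f;
  vcomp : forall {A B : ob} {f g h : arr A B},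
    cell g h -> cell f g -> cell f h;
  lwhisk : forall {A B C : ob} (g : arr B C) {f f' : arr A B},
    cell f f' -> cell (comp1 g f) (comp1 g f');
  rwhisk : forall {A B C : ob} {g g' : arr B C},
    cell g g' -> forall f : arr A B, cell (comp1 g f) (comp1 g' f);
  lunit : forall {A B : ob} (f : arr A B), cell (comp1 (id1 B) f) f;
  lunit_inv : forall {A B : ob} (f : arr A B), cell f (comp1 (id1 B) f);
  runit : forall {A B : ob} (f : arr A B), cell (comp1 f (id1 A)) f;
  runit_inv : forall {A B : ob} (f : arr A B), cell f (comp1 f (id1 A));
  assoc : forall {A B C D : ob} (h : arr C D) (g : arr B C) (f : arr A B),
    cell (comp1 (comp1 h g) f) (comp1 h (comp1 g f));
  assoc_inv : forall {A B C D : ob} (h : arr C D) (g : arr B C) (f : arr A B),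
    cell (comp1 h (comp1 g f)) (comp1 (comp1 h g) f)
}.

Arguments arr {_} _ _.
Arguments cell {_ _ _} _ _.
Arguments id1 {_} A.
Arguments comp1 {_ _ _ _} g f.
Arguments id2 {_ _ _} f.
Arguments vcomp {_ _ _ _ _ _} β α.
Arguments lwhisk {_ _ _ _} g {_ _} α.
Arguments rwhisk {_ _ _ _ _ _} β f.
Arguments lunit {_ _ _} f.
Arguments lunit_inv {_ _ _} f.
Arguments runit {_ _ _} f.
Arguments runit_inv {_ _ _} f.
Arguments assoc {_ _ _ _ _} h g f.
Arguments assoc_inv {_ _ _ _ _} h g f.

Notation "f ⇒ g" := (cell f g) : bicat_scope.
Notation "g ∘ f" := (comp1 g f) : bicat_scope.
Notation "β • α" := (vcomp β α) : bicat_scope.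
Notation "g ◁ α" := (lwhisk g α) : bicat_scope.
Notation "β ▷ f" := (rwhisk β f) : bicat_scope.

Record bicat_laws (B : bicat_data) : Prop := BicatLaws {
  vcomp_id_l : forall (X Y : B) (f g : arr X Y) (α : f ⇒ g),
    id2 g • α = α;
  vcomp_id_r : forall (X Y : B) (f g : arr X Y) (α : f ⇒ g),
    α • id2 f = α;
  vcomp_assoc : forall (X Y : B) (f g h k : arr X Y)
      (α : f ⇒ g) (β : g ⇒ h) (γ : h ⇒ k),
    γ • (β • α) = (γ • β) • α;

  lwhisk_id2 : forall (X Y Z : B) (g : arr Y Z) (f : arr X Y),
    g ◁ id2 f = id2 (g ∘ f);
  lwhisk_vcomp : forall (X Y Z : B) (g : arr Y Z) (f f' f'' : arr X Y)
      (α : f ⇒ f') (α' : f' ⇒ f''),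
    g ◁ (α' • α) = (g ◁ α') • (g ◁ α);
  rwhisk_id2 : forall (X Y Z : B) (g : arr Y Z) (f : arr X Y),
    id2 g ▷ f = id2 (g ∘ f);
  rwhisk_vcomp : forall (X Y Z : B) (g g' g'' : arr Y Z) (f : arr X Y)
      (β : g ⇒ g') (β' : g' ⇒ g''),
    (β' • β) ▷ f = (β' ▷ f) • (β ▷ f);
  interchange : forall (X Y Z : B) (g g' : arr Y Z) (f f' : arr X Y)
      (β : g ⇒ g') (α : f ⇒ f'),
    (g' ◁ α) • (β ▷ f) = (β ▷ f') • (g ◁ α);

  lunit_natural : forall (X Y : B) (f f' : arr X Y) (α : f ⇒ f'),
    lunit f' • (id1 Y ◁ α) = α • lunit f;
  runit_natural : forall (X Y : B) (f f' : arr X Y) (α : f ⇒ f'),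
    runit f' • (α ▷ id1 X) = α • runit f;
  assoc_natural_l : forall (X Y Z T : B)
      (h h' : arr Z T) (g : arr Y Z) (f : arr X Y) (γ : h ⇒ h'),
    assoc h' g f • ((γ ▷ g) ▷ f) = (γ ▷ (g ∘ f)) • assoc h g f;
  assoc_natural_m : forall (X Y Z T : B)
      (h : arr Z T) (g g' : arr Y Z) (f : arr X Y) (β : g ⇒ g'),
    assoc h g' f • ((h ◁ β) ▷ f) = (h ◁ (β ▷ f)) • assoc h g f;
  assoc_natural_r : forall (X Y Z T : B)
      (h : arr Z T) (g : arr Y Z) (f f' : arr X Y) (α : f ⇒ f'),
    assoc h g f' • ((h ∘ g) ◁ α) = (h ◁ (g ◁ α)) • assoc h g f;

  lunit_lunit_inv : forall (X Y : B) (f : arr X Y),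
    lunit f • lunit_inv f = id2 f;
  lunit_inv_lunit : forall (X Y : B) (f : arr X Y),
    lunit_inv f • lunit f = id2 (id1 Y ∘ f);
  runit_runit_inv : forall (X Y : B) (f : arr X Y),
    runit f • runit_inv f = id2 f;
  runit_inv_runit : forall (X Y : B) (f : arr X Y),
    runit_inv f • runit f = id2 (f ∘ id1 X);
  assoc_assoc_inv : forall (X Y Z T : B)
      (h : arr Z T) (g : arr Y Z) (f : arr X Y),
    assoc h g f • assoc_inv h g f = id2 (h ∘ (g ∘ f));
  assoc_inv_assoc : forall (X Y Z T : B)
      (h : arr Z T) (g : arr Y Z) (f : arr X Y),
    assoc_inv h g f • assoc h g f = id2 ((h ∘ g) ∘ f);

  triangle : forall (X Y Z : B) (g : arr Y Z) (f : arr X Y),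
    (g ◁ lunit f) • assoc g (id1 Y) f = runit g ▷ f;
  pentagon : forall (X Y Z T U : B)
      (k : arr T U) (h : arr Z T) (g : arr Y Z) (f : arr X Y),
    (k ◁ assoc h g f) • assoc k (h ∘ g) f • (assoc k h g ▷ f)
    = assoc k h (g ∘ f) • assoc (k ∘ h) g f
}.

Record bicategory := Bicategory {
  bicat_of :> bicat_data;
  bicat_of_laws : bicat_laws bicat_of
}.

Definition invertible {B : bicategory} {X Y : B} {f g : arr X Y}
    (α : f ⇒ g) : Prop :=
  exists α' : g ⇒ f, α' • α = id2 f /\ α • α' = id2 g.

(** The whiskering [α p] of [α : u s ⇒ v t] with [p], rebracketed as a 2-cell
    [u (s p) ⇒ v (t p)].  Below, triple composites are bracketed to the right
    and all suppressed associativity constraints are of this form. *)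
Definition rwhisk_assoc {B : bicategory} {X Y Y' Z W : B}
    {u : arr Y Z} {s : arr X Y} {v : arr Y' Z} {t : arr X Y'}
    (α : u ∘ s ⇒ v ∘ t) (p : arr W X) : u ∘ (s ∘ p) ⇒ v ∘ (t ∘ p) :=
  assoc v t p • (α ▷ p) • assoc_inv u s p.

Notation "α ▷a p" := (rwhisk_assoc α p)
  (at level 38, right associativity) : bicat_scope.

Definition arrow_class (B : bicategory) : Type :=
  forall X Y : B, arr X Y -> Prop.

Definition co_ff {B : bicategory} {X Y : B} (w : arr X Y) : Prop :=
  forall (Z : B) (f g : arr Y Z) (α : f ∘ w ⇒ g ∘ w),
    exists! α' : f ⇒ g, α' ▷ w = α.

Section Fractions.

Context {B : bicategory} (W : arrow_class B).

Local Notation "f ∈W" := (W _ _ f) (at level 70).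

(** [(u, β)] is a lifting of [α] along [w] in the sense of [WB4]. *)
Definition WB4_lifting {X Y Z : B} (w : arr Y Z) (f g : arr X Y)
    (α : w ∘ f ⇒ w ∘ g) {X' : B} (u : arr X' X) (β : f ∘ u ⇒ g ∘ u) : Prop :=
  u ∈W /\ α ▷a u = w ◁ β.

Record WB : Prop := {
  WB1 : forall X : B, id1 X ∈W;
  WB2 : forall (Y Z T : B) (v : arr Y Z) (w : arr Z T), v ∈W -> w ∈W ->
    exists (X : B) (u : arr X Y), w ∘ (v ∘ u) ∈W;
  WB3 : forall (X Y Z : B) (w : arr X Y) (f : arr Z Y), w ∈W ->
    exists (T : B) (h : arr T X) (v : arr T Z) (α : w ∘ h ⇒ f ∘ v),
      v ∈W /\ invertible α;
  WB4_exists : forall (X Y Z : B) (w : arr Y Z) (f g : arr X Y)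
      (α : w ∘ f ⇒ w ∘ g), w ∈W ->
    exists (X' : B) (u : arr X' X) (β : f ∘ u ⇒ g ∘ u),
      WB4_lifting w f g α u β;
  WB4_unique : forall (X Y Z : B) (w : arr Y Z) (f g : arr X Y)
      (α : w ∘ f ⇒ w ∘ g), w ∈W ->
    forall (X1 X2 : B) (u1 : arr X1 X) (u2 : arr X2 X)
      (β1 : f ∘ u1 ⇒ g ∘ u1) (β2 : f ∘ u2 ⇒ g ∘ u2),
    WB4_lifting w f g α u1 β1 -> WB4_lifting w f g α u2 β2 ->
    exists (T : B) (s : arr T X1) (t : arr T X2) (ε : u1 ∘ s ⇒ u2 ∘ t),
      u1 ∘ s ∈W /\ u2 ∘ t ∈W /\ invertible ε /\
      (g ◁ ε) • (β1 ▷a s) = (β2 ▷a t) • (f ◁ ε);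
  WB5 : forall (X Y : B) (v w : arr X Y) (α : v ⇒ w),
    w ∈W -> invertible α -> v ∈W
}.

Record span (X Y : B) := Span {
  apex : B;
  bwd : arr apex X;
  fwd : arr apex Y;
  bwd_W : bwd ∈W
}.

Arguments apex {_ _} _.
Arguments bwd {_ _} _.
Arguments fwd {_ _} _.

Record left_cell {X Y : B} (σ1 σ2 : span X Y) := LeftCell {
  l_apex : B;
  leg1 : arr l_apex (apex σ1);
  leg2 : arr l_apex (apex σ2);
  l_cell : bwd σ1 ∘ leg1 ⇒ bwd σ2 ∘ leg2
}.

Arguments l_apex {_ _ _ _} _.
Arguments leg1 {_ _ _ _} _.
Arguments leg2 {_ _ _ _} _.
Arguments l_cell {_ _ _ _} _.

Definition left_admissible {X Y : B} {σ1 σ2 : span X Y}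
    (l : left_cell σ1 σ2) : Prop :=
  invertible (l_cell l) /\ bwd σ1 ∘ leg1 l ∈W.

Record diagram {X Y : B} (σ1 σ2 : span X Y) := Diagram {
  left_hand : left_cell σ1 σ2;
  right_hand : fwd σ1 ∘ leg1 left_hand ⇒ fwd σ2 ∘ leg2 left_hand;
  left_hand_admissible : left_admissible left_hand
}.

Arguments Diagram {_ _ _ _} _ _ _.
Arguments left_hand {_ _ _ _} _.
Arguments right_hand {_ _ _ _} _.

Definition equivalent {X Y : B} {σ1 σ2 : span X Y}
    (d d' : diagram σ1 σ2) : Prop :=
  let l := left_hand d in let l' := left_hand d' in
  exists (E : B) (p : arr E (l_apex l)) (q : arr E (l_apex l'))
    (ε1 : leg1 l ∘ p ⇒ leg1 l' ∘ q) (ε2 : leg2 l ∘ p ⇒ leg2 l' ∘ q),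
    invertible ε1 /\ invertible ε2 /\
    bwd σ1 ∘ (leg1 l ∘ p) ∈W /\
    (bwd σ2 ◁ ε2) • (l_cell l ▷a p) = (l_cell l' ▷a q) • (bwd σ1 ◁ ε1) /\
    (fwd σ2 ◁ ε2) • (right_hand d ▷a p)
      = (right_hand d' ▷a q) • (fwd σ1 ◁ ε1).

(** A 2-cell of [B(W^-1)], given as the set of its representatives. *)
Record frac_cell {X Y : B} (σ1 σ2 : span X Y) := FracCell {
  represents : diagram σ1 σ2 -> Prop;
  represents_nonempty : exists d, represents d;
  represents_class : forall d, represents d ->
    forall d', represents d' <-> equivalent d d'
}.

End Fractions.

Arguments span {_} W X Y.
Arguments apex {_ _ _ _} _.
Arguments bwd {_ _ _ _} _.
Arguments fwd {_ _ _ _} _.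
Arguments left_cell {_ _ _ _} σ1 σ2.
Arguments LeftCell {_ _ _ _ _ _} _ _ _ _.
Arguments l_apex {_ _ _ _ _ _} _.
Arguments leg1 {_ _ _ _ _ _} _.
Arguments leg2 {_ _ _ _ _ _} _.
Arguments l_cell {_ _ _ _ _ _} _.
Arguments left_admissible {_ _ _ _ _ _} l.
Arguments diagram {_ _ _ _} σ1 σ2.
Arguments Diagram {_ _ _ _ _ _} _ _ _.
Arguments left_hand {_ _ _ _ _ _} _.
Arguments right_hand {_ _ _ _ _ _} _.
Arguments left_hand_admissible {_ _ _ _ _ _} _.
Arguments equivalent {_ _ _ _ _ _} d d'.
Arguments frac_cell {_ _ _ _} σ1 σ2.
Arguments represents {_ _ _ _ _ _} _ _.

(* Main.v *)
(** The key point is that the arrows of [W] are not only co-ff but also ff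
    (whiskering with them on the left is bijective on 2-cells): a lifting
    furnished by [WB4] along [u] descends because [u] is co-ff, and its
    uniqueness up to refinement becomes strict uniqueness for the same reason.
    If [(ε1, ε2)] over [(p, q)] witnesses the equivalence of two diagrams with
    the same left-hand 2-cell, then, [u1] and [u1 s1] being ff, so is [s1],
    whence [ε1 = s1 ζ] for a unique invertible [ζ : p ⇒ q]; compatibility with
    the left-hand 2-cell and the ffness of [u2] give [ε2 = s2 ζ].  Naturality
    then turns compatibility with the right-hand 2-cells into [β p = γ p].
    Finally [p] can be cancelled, since [p h] is isomorphic to an arrow of [W]
    for some [h] by [WB3]. *)

From Stdlib Require Import ProofIrrelevance.
Require Import Defs.

Local Open Scope bicat_scope.

Section Bicategory.

Context {B : bicategory}.

Local Notation laws := (bicat_of_laws B).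

(** * Invertible 2-cells: cancellation and closure properties *)

Lemma invertible_mono {X Y : B} {f g h : arr X Y} (α : g ⇒ h) (x y : f ⇒ g) :
  invertible α -> α • x = α • y -> x = y.
Proof.
  intros [α' [H _]] E.
  rewrite <- (vcomp_id_l _ laws _ _ _ _ x), <- (vcomp_id_l _ laws _ _ _ _ y), <- H.
  now rewrite <- !(vcomp_assoc _ laws), E.
Qed.

Lemma invertible_epi {X Y : B} {f g h : arr X Y} (α : f ⇒ g) (x y : g ⇒ h) :
  invertible α -> x • α = y • α -> x = y.
Proof.
  intros [α' [_ H]] E.
  rewrite <- (vcomp_id_r _ laws _ _ _ _ x), <- (vcomp_id_r _ laws _ _ _ _ y), <- H.
  now rewrite !(vcomp_assoc _ laws), E.
Qed.

Lemma invertible_assoc {X Y Z T : B} (h : arr Z T) (g : arr Y Z) (f : arr X Y) :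
  invertible (assoc h g f).
Proof.
  exists (assoc_inv h g f); split.
  - apply (assoc_inv_assoc _ laws).
  - apply (assoc_assoc_inv _ laws).
Qed.

Lemma invertible_assoc_inv {X Y Z T : B} (h : arr Z T) (g : arr Y Z) (f : arr X Y) :
  invertible (assoc_inv h g f).
Proof.
  exists (assoc h g f); split.
  - apply (assoc_assoc_inv _ laws).
  - apply (assoc_inv_assoc _ laws).
Qed.

Lemma invertible_lwhisk {X Y Z : B} (g : arr Y Z) {f f' : arr X Y} (α : f ⇒ f') :
  invertible α -> invertible (g ◁ α).
Proof.
  intros [α' [H H']]; exists (g ◁ α'); split;
    rewrite <- (lwhisk_vcomp _ laws), ?H, ?H'; apply (lwhisk_id2 _ laws).
Qed.

Lemma invertible_rwhisk {X Y Z : B} {g g' : arr Y Z} (β : g ⇒ g') (f : arr X Y) :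
  invertible β -> invertible (β ▷ f).
Proof.
  intros [β' [H H']]; exists (β' ▷ f); split;
    rewrite <- (rwhisk_vcomp _ laws), ?H, ?H'; apply (rwhisk_id2 _ laws).
Qed.

Lemma invertible_vcomp {X Y : B} {f g h : arr X Y} (β : g ⇒ h) (α : f ⇒ g) :
  invertible β -> invertible α -> invertible (β • α).
Proof.
  intros [β' [H1 H2]] [α' [H3 H4]]; exists (α' • β'); split.
  - now rewrite (vcomp_assoc _ laws), <- (vcomp_assoc _ laws _ _ _ _ _ _ β β' α'),
      H1, (vcomp_id_r _ laws).
  - now rewrite (vcomp_assoc _ laws), <- (vcomp_assoc _ laws _ _ _ _ _ _ α' α β),
      H4, (vcomp_id_r _ laws).
Qed.

Lemma invertible_rwhisk_assoc {X Y Y' Z W : B}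
    {u : arr Y Z} {s : arr X Y} {v : arr Y' Z} {t : arr X Y'}
    (α : u ∘ s ⇒ v ∘ t) (p : arr W X) :
  invertible α -> invertible (α ▷a p).
Proof.
  intro Hα; unfold rwhisk_assoc.
  apply invertible_vcomp; [apply invertible_vcomp|].
  - apply invertible_assoc.
  - now apply invertible_rwhisk.
  - apply invertible_assoc_inv.
Qed.

(** * Calculus of the rebracketed whiskering [▷a] *)

Lemma rwhisk_assoc_inj {X Y Y' Z W : B}
    {u : arr Y Z} {s : arr X Y} {v : arr Y' Z} {t : arr X Y'}
    (α β : u ∘ s ⇒ v ∘ t) (p : arr W X) :
  α ▷a p = β ▷a p -> α ▷ p = β ▷ p.
Proof.
  unfold rwhisk_assoc; intro H.
  apply (invertible_epi _ _ _ (invertible_assoc_inv u s p)) in H.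
  exact (invertible_mono _ _ _ (invertible_assoc v t p) H).
Qed.

(** Precomposing with the associator reduces this to [interchange] for [α] and [ζ], by naturality of
    the associator in its last argument at both ends. *)
Lemma rwhisk_assoc_natural {X Y Y' Z W : B}
    {u : arr Y Z} {s : arr X Y} {v : arr Y' Z} {t : arr X Y'}
    (α : u ∘ s ⇒ v ∘ t) {p q : arr W X} (ζ : p ⇒ q) :
  (α ▷a q) • (u ◁ s ◁ ζ) = (v ◁ t ◁ ζ) • (α ▷a p).
Proof.
  apply (invertible_epi _ _ _ (invertible_assoc u s p)); unfold rwhisk_assoc.
  rewrite <- !(vcomp_assoc _ laws).
  rewrite (assoc_inv_assoc _ laws), <- (assoc_natural_r _ laws), (vcomp_id_r _ laws).
  rewrite (vcomp_assoc _ laws _ _ _ _ _ _ _ (assoc u s q) (assoc_inv u s q)).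
  rewrite (assoc_inv_assoc _ laws), (vcomp_id_l _ laws).
  rewrite <- (interchange _ laws), !(vcomp_assoc _ laws).
  now rewrite <- (assoc_natural_r _ laws).
Qed.

Lemma rwhisk_assoc_lwhisk {X Y Z T : B} (h : arr Z T) {g g' : arr Y Z}
    (β : g ⇒ g') (f : arr X Y) :
  (h ◁ β) ▷a f = h ◁ (β ▷ f).
Proof.
  unfold rwhisk_assoc.
  now rewrite (assoc_natural_m _ laws), <- (vcomp_assoc _ laws),
    (assoc_assoc_inv _ laws), (vcomp_id_r _ laws).
Qed.

Lemma rwhisk_assoc_rwhisk {X Y Z T : B} {h h' : arr Z T} (γ : h ⇒ h')
    (g : arr Y Z) (f : arr X Y) :
  (γ ▷ g) ▷a f = γ ▷ (g ∘ f).
Proof.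
  unfold rwhisk_assoc.
  now rewrite (assoc_natural_l _ laws), <- (vcomp_assoc _ laws),
    (assoc_assoc_inv _ laws), (vcomp_id_r _ laws).
Qed.

(** * Co-ff and ff arrows *)

Lemma co_ff_inj {X Y Z : B} (w : arr X Y) {f g : arr Y Z} (α β : f ⇒ g) :
  co_ff w -> α ▷ w = β ▷ w -> α = β.
Proof.
  intros Hw H; destruct (Hw _ _ _ (β ▷ w)) as [γ [_ U]].
  now rewrite <- (U α H), <- (U β eq_refl).
Qed.

Definition ff {Y Z : B} (w : arr Y Z) : Prop :=
  forall (X : B) (f g : arr X Y) (α : w ∘ f ⇒ w ∘ g),
    exists! α' : f ⇒ g, w ◁ α' = α.

Lemma ff_inj {X Y Z : B} (w : arr Y Z) {f g : arr X Y} (α β : f ⇒ g) :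
  ff w -> w ◁ α = w ◁ β -> α = β.
Proof.
  intros Hw H; destruct (Hw _ _ _ (w ◁ β)) as [γ [_ U]].
  now rewrite <- (U α H), <- (U β eq_refl).
Qed.

Lemma ff_reflects_invertible {X Y Z : B} (w : arr Y Z) {f g : arr X Y}
    (ζ : f ⇒ g) :
  ff w -> invertible (w ◁ ζ) -> invertible ζ.
Proof.
  intros Hw [α [H1 H2]]; destruct (Hw _ _ _ α) as [ζ' [<- _]].
  exists ζ'; split; apply (ff_inj w); trivial;
    now rewrite (lwhisk_vcomp _ laws), (lwhisk_id2 _ laws).
Qed.

(** A 2-cell [ζ] satisfies [s ◁ ζ = ε] iff [(u ∘ s) ◁ ζ] is [u ◁ ε] up to rebracketing, since [u] is
    ff; and [u ∘ s] is ff as well. *)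
Lemma ff_right_factor {X Y Z : B} (u : arr Y Z) (s : arr X Y) :
  ff u -> ff (u ∘ s) -> ff s.
Proof.
  intros Hu Hus T p q ε.
  destruct (Hus _ p q (assoc_inv u s q • (u ◁ ε) • assoc u s p)) as [ζ [Hζ U]].
  exists ζ; split.
  - apply (ff_inj u); trivial.
    apply (invertible_epi _ _ _ (invertible_assoc u s p)).
    now rewrite <- (assoc_natural_r _ laws), Hζ, !(vcomp_assoc _ laws),
      (assoc_assoc_inv _ laws), (vcomp_id_l _ laws).
  - intros ζ' <-; apply U.
    now rewrite <- (vcomp_assoc _ laws), <- (assoc_natural_r _ laws),
      (vcomp_assoc _ laws), (assoc_inv_assoc _ laws), (vcomp_id_l _ laws).
Qed.

End Bicategory.

(** * Arrows of [W] are ff; cancellation in diagrams *)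

Section CoFF.

Context {B : bicategory} {W : arrow_class B}
  (W_co_ff : forall (X Y : B) (w : arr X Y), W X Y w -> co_ff w) (W_WB : WB W).

Local Notation laws := (bicat_of_laws B).

(** Both 2-cells, whiskered with an identity, are liftings of the same 2-cell in the sense of [WB4];
    uniqueness there compares them only after refinement. *)
Lemma W_lwhisk_inj {X Y Z : B} (w : arr Y Z) {f g : arr X Y} (β1 β2 : f ⇒ g) :
  W _ _ w -> w ◁ β1 = w ◁ β2 -> β1 = β2.
Proof.
  intros Hw H.
  assert (lift : forall β : f ⇒ g, w ◁ β = w ◁ β2 ->
      WB4_lifting W w f g (w ◁ β2) (id1 X) (β ▷ id1 X)).
  { intros β <-; split; [apply (WB1 _ W_WB) | apply rwhisk_assoc_lwhisk]. }
  destruct (WB4_unique _ W_WB _ _ _ w f g (w ◁ β2) Hw _ _ _ _ _ _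
      (lift β1 H) (lift β2 eq_refl)) as (T & s & t & ε & _ & Ht & Hε & E).
  (* Interchange moves [ε] to the right of [β1]; once it is cancelled, [β1] and [β2] agree after
     whiskering with [id1 X ∘ t], which lies in [W]. *)
  rewrite !rwhisk_assoc_rwhisk, (interchange _ laws) in E.
  apply invertible_epi in E; [|now apply invertible_lwhisk].
  exact (co_ff_inj _ _ _ (W_co_ff _ _ _ Ht) E).
Qed.

Lemma W_ff {Y Z : B} (w : arr Y Z) : W _ _ w -> ff w.
Proof.
  intros Hw X f g α.
  destruct (WB4_exists _ W_WB _ _ _ w f g α Hw) as (X' & u & β & Hu & Hβ).
  destruct (W_co_ff _ _ _ Hu _ _ _ β) as [β' [<- _]].
  (* Tested after whiskering with the co-ff arrow [u]. *)
  assert (H : w ◁ β' = α).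
  { apply (co_ff_inj u); [now apply W_co_ff|].
    apply rwhisk_assoc_inj; now rewrite rwhisk_assoc_lwhisk. }
  exists β'; split; trivial.
  intros β'' H'; apply (W_lwhisk_inj w); trivial; congruence.
Qed.

Lemma W_rwhisk_inj_right_factor {X Y Z T : B} (w : arr Y Z) (p : arr X Y)
    {f g : arr Y T} (x y : f ⇒ g) :
  W _ _ w -> W _ _ (w ∘ p) -> x ▷ p = y ▷ p -> x = y.
Proof.
  intros Hw Hwp H.
  (* Here [α] goes from [(w ∘ p) ∘ h] to [w ∘ v], so it lifts through the ff arrow [w] to an
     invertible [ζ : p ∘ h ⇒ v]. *)
  destruct (WB3 _ W_WB _ _ _ (w ∘ p) w Hwp) as (S & h & v & α & Hv & Hα).
  destruct (W_ff w Hw _ (p ∘ h) v (α • assoc_inv w p h)) as [ζ [Hζ _]].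
  assert (ζ_inv : invertible ζ).
  { apply (ff_reflects_invertible w); [now apply W_ff|].
    rewrite Hζ; apply invertible_vcomp; [assumption | apply invertible_assoc_inv]. }
  apply (co_ff_inj v); [now apply W_co_ff|].
  apply (invertible_epi (f ◁ ζ)); [now apply invertible_lwhisk|].
  now rewrite <- !(interchange _ laws), <- !rwhisk_assoc_rwhisk, H.
Qed.

Lemma equivalent_right_hand {X Y : B} {σ1 σ2 : span W X Y} (l : left_cell σ1 σ2)
    (l_adm l_adm' : left_admissible l)
    (β γ : fwd σ1 ∘ leg1 l ⇒ fwd σ2 ∘ leg2 l) :
  equivalent (Diagram l β l_adm) (Diagram l γ l_adm') -> β = γ.
Proof.
  destruct l as [D s1 s2 α], σ1 as [C1 u1 f1 Hu1], σ2 as [C2 u2 f2 Hu2].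
  intros (E & p & q & ε1 & ε2 & Hε1 & Hε2 & Hp & HL & HR).
  destruct l_adm as [Hα Hw].
  cbn in *.
  assert (s1_ff : ff s1) by (apply (ff_right_factor u1); now apply W_ff).
  destruct (s1_ff _ _ _ ε1) as [ζ [<- _]].
  apply ff_reflects_invertible in Hε1; trivial.
  assert (Eε2 : s2 ◁ ζ = ε2).
  { apply (W_lwhisk_inj u2); trivial.
    apply (invertible_epi (α ▷a p)); [now apply invertible_rwhisk_assoc|].
    (* Naturality moves [ζ] across [α], so both sides become [(u2 ◁ s2 ◁ ζ) • (α ▷a p)]. *)
    now rewrite HL, rwhisk_assoc_natural. }
  subst ε2; rewrite rwhisk_assoc_natural in HR.
  apply invertible_mono in HR; [|now apply invertible_lwhisk].
  apply (W_rwhisk_inj_right_factor (u1 ∘ s1) p); trivial.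
  (* The associator carries membership in [W] from [u1 ∘ (s1 ∘ p)] to [(u1 ∘ s1) ∘ p]. *)
  - exact (WB5 _ W_WB _ _ _ _ (assoc u1 s1 p) Hp (invertible_assoc _ _ _)).
  - now apply rwhisk_assoc_inj.
Qed.

End CoFF.

Theorem theorem5p6 (B : bicategory) (W : arrow_class B)
    (W_co_ff : forall (X Y : B) (w : arr X Y), W X Y w -> co_ff w)
    (W_WB : WB W) (X Y : B) (σ1 σ2 : span W X Y) :
  (forall (c : frac_cell σ1 σ2) (d d' : diagram σ1 σ2),
     represents c d -> represents c d' ->
     left_hand d = left_hand d' -> d = d') /\
  (forall (l : left_cell σ1 σ2) (l_adm l_adm' : left_admissible l)
     (β γ : fwd σ1 ∘ leg1 l ⇒ fwd σ2 ∘ leg2 l),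
     equivalent (Diagram l β l_adm) (Diagram l γ l_adm') -> β = γ).
Proof.
  split.
  - intros c [l β l_adm] [l' γ l_adm'] Hd Hd' E; cbn in E; subst l'.
    apply (represents_class _ _ _ c _ Hd) in Hd'.
    apply (equivalent_right_hand W_co_ff W_WB) in Hd'; subst γ.
    (* The two diagrams now differ at most in their proofs of admissibility. *)
    f_equal; apply proof_irrelevance.
  - exact (@equivalent_right_hand B W W_co_ff W_WB X Y σ1 σ2).
Qed.
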